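(* Let $m>0$ and $p>1$ satisfy $\gamma := m(p-1)-1\ge 0$. Let $f\in C^1[0,1]$ with $f(0)=f(1)=0$, $f(u)>0$ for $u\in(0,1)$, and $f$ concave on $[0,1]$. Then the minimal travelling wave speed $c_*=c_*(m,p)$ of $\partial_t u=\partial_x\left(|\partial_x u^m|^{p-2}\partial_x u^m\right)+f(u)$ satisfies $$c_*\ge\left(\frac{mp}{p-1}\right)^{(p-1)/p}\left[\int_0^1 u^{m-1}f(u)\,du\right]^{(p-1)/p}.$$
   Context: Travelling waves and $c_*$: a travelling wave of speed $c>0$ joining the equilibria $0$ and $1$ is a (weak) solution $u(\xi)$, $\xi=x+ct$, of the equation, with values in $[0,1]$, monotone increasing (with $u_\xi>0$ where $0<u<1$), $u\to0$ as $\xi\to-\infty$ and $u\to1$ as $\xi\to+\infty$; it satisfies $$c\,u_\xi=m^{p-1}\frac{d}{d\xi}\left(u^{(m-1)(p-1)}(u_\xi)^{p-1}\right)+f(u)$$ where $0<u<1$. The wave may be finite, i.e. vanish identically on a left half-line, with continuous flux. In terms of the phase-space coordinate $q(u)=u^{m-1}u_\xi$, regarded as a function of $u\in(0,1)$, the equation reads $$\frac{c}{m^{p-1}}=\frac{d}{du}\left(q(u)^{p-1}\right)+\frac{F(u)}{q(u)},$$ with $q>0$ on $(0,1)$, $q(0)=q(1)=0$, where $F(u)=u^{m-1}f(u)/m^{p-1}$. For $\gamma\ge0$ it is known that there is a number $c_*(m,p)>0$ such that a travelling wave joining $0$ and $1$, unique up to translation, exists for every $c\ge c_*(m,p)$ and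 none exists for $0<c<c_*(m,p)$. This number is the minimal speed $c_*(m,p)$ (it depends on $f$ as well). *)

(* Defs.v *)
From HB Require Import structures.
From mathcomp Require Import all_boot all_order all_algebra.
From mathcomp Require Import all_classical all_reals all_analysis.

Set Implicit Arguments.
Unset Strict Implicit.
Unset Printing Implicit Defensive.

Import Order.TTheory GRing.Theory Num.Theory.
Import numFieldNormedType.Exports.

Local Open Scope ring_scope.
Local Open Scope classical_set_scope.

(* The derivative on the closed interval is taken relative to it, hence is
   one-sided at 0 and 1; values of f outside [0, 1] are irrelevant. *)
Definition C1_on_unit (R : realType) (f : R -> R) : Prop :=
  exists2 f' : R -> R,
    {within `[0, 1], continuous f'} &
    forall x : R, x \in `[0, 1] ->
      (y - x)^-1 * (f y - f x) @[y --> within `[0, 1] x^'] --> f' x.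

Definition concave_on_unit (R : realType) (f : R -> R) : Prop :=
  convex_function (`[0, 1]%classic : set R) (fun u : R => - f u).

(* Functions of (x, t) are curried. *)
Definition partial_x (R : realType) (v : R -> R -> R) (x t : R) : R :=
  derive1 (fun y => v y t) x.

Definition partial_t (R : realType) (v : R -> R -> R) (x t : R) : R :=
  derive1 (fun s => v x s) t.

Definition test_function (R : realType) (phi : R -> R -> R) : Prop :=
  [/\ forall x t, derivable (fun y => phi y t) x 1,
      forall x t, derivable (fun s => phi x s) t 1,
      continuous (fun z : R * R => partial_x phi z.1 z.2),
      continuous (fun z : R * R => partial_t phi z.1 z.2) &
      compact (closure [set z : R * R | phi z.1 z.2 != 0])].

(* |d_x v^m|^(p-2) d_x v^m. The factor |w|^(p-2) is finite at w = 0 by the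
   convention on powR, so the product vanishes there, as it should for p > 1. *)
Definition flux (R : realType) (m p : R) (v : R -> R -> R) (x t : R) : R :=
  let w := partial_x (fun y s => v y s `^ m) x t in `|w| `^ (p - 2) * w.

(* Weak solutions, on the whole plane, of
     d_t v = d_x (|d_x v^m|^(p-2) d_x v^m) + f(v),
   that are nonnegative, continuous and have continuous flux. *)
Record weak_solution (R : realType) (m p : R) (f : R -> R) (v : R -> R -> R)
    : Prop := {
  weak_ge0 : forall x t, 0 <= v x t;
  weak_continuous : continuous (fun z : R * R => v z.1 z.2);
  weak_derivable : forall x t, derivable (fun y => v y t `^ m) x 1;
  weak_flux_continuous : continuous (fun z : R * R => flux m p v z.1 z.2);
  weak_equation : forall phi : R -> R -> R, test_function phi ->
    \int[(lebesgue_measure \x lebesgue_measure)%E]_(z in [set: R * R])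
       (v z.1 z.2 * partial_t phi z.1 z.2
        - flux m p v z.1 z.2 * partial_x phi z.1 z.2
        + f (v z.1 z.2) * phi z.1 z.2) = 0
}.

(* The profile may vanish on a left half-line, where it need not be
   differentiable at the free boundary: the pointwise equation is required only
   where 0 < u < 1. *)
Record travelling_wave (R : realType) (m p : R) (f : R -> R) (c : R)
    (u : R -> R) : Prop := {
  tw_weak_solution : weak_solution m p f (fun x t => u (x + c * t));
  tw_range : forall xi, 0 <= u xi <= 1;
  tw_nondecreasing : {homo u : x y / x <= y};
  tw_derivable : forall xi, 0 < u xi < 1 -> derivable u xi 1;
  tw_derive_gt0 : forall xi, 0 < u xi < 1 -> 0 < derive1 u xi;
  tw_cvg_ninfty : u xi @[xi --> -oo] --> (0 : R);
  tw_cvg_pinfty : u xi @[xi --> +oo] --> (1 : R);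
  tw_equation : forall xi, 0 < u xi < 1 ->
    let F := fun z => u z `^ ((m - 1) * (p - 1)) * derive1 u z `^ (p - 1) in
    derivable F xi 1 /\
    c * derive1 u xi = m `^ (p - 1) * derive1 F xi + f (u xi)
}.

Definition has_wave (R : realType) (m p : R) (f : R -> R) (c : R) : Prop :=
  exists u : R -> R, travelling_wave m p f c u.

(* c_* is characterized as the threshold of admissible speeds; there is at most
   one such number. *)
Definition minimal_speed (R : realType) (m p : R) (f : R -> R) (cstar : R)
    : Prop :=
  [/\ 0 < cstar,
      forall c, cstar <= c -> has_wave m p f c &
      forall c, 0 < c < cstar -> ~ has_wave m p f c].

(* Main.v *)
Require Import Defs.
From HB Require Import structures.
From mathcomp Require Import all_boot all_order all_algebra.
From mathcomp Require Import all_classical all_reals all_analysis.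
From mathcomp Require Import ring.

Set Implicit Arguments.
Unset Strict Implicit.
Unset Printing Implicit Defensive.

Import Order.TTheory GRing.Theory Num.Theory.
Import numFieldNormedType.Exports.

Local Open Scope ring_scope.
Local Open Scope classical_set_scope.

(** The bound holds for every speed c of a wave u, hence for the threshold c_*,
    which is itself such a speed. Let w := (u^m)' and let W := w^(p-1) be the
    flux, so that the profile equation reads W' = c u' - f(u) where 0 < u < 1.

    Since f > 0, W - c u is nonincreasing; as it tends to 0 at the left end of
    the front, W <= c u ([wave_flux_le]). Put k := p/(p-1), the conjugate
    exponent of p, so that W^(k-1) = w = m u^(m-1) u'. Multiplying the equation
    by w and integrating suggests the energy
      H := G(u) + (p-1)/(mp) (W^k - (c u)^k),  G(y) := int_0^y s^(m-1) f(s) ds,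
    for which all terms in f cancel:
      H' = (c u'/m) (W^(k-1) - (c u)^(k-1)) <= 0.
    Now H tends to 0 at the left end, so H <= 0, and W >= 0 leaves
    G(u) <= (p-1)/(mp) (c u)^k. As u takes every value in ]0, 1[, letting
    u -> 1 gives G(1) <= (p-1)/(mp) c^k, which is the claim.

    This is the phase-plane argument for q = u^(m-1) u' (note w = m q), written
    in the variable xi so that no inverse of the profile is needed. Its delicate
    point is that W and u become small together at the left end
    ([wave_left_end]): for a finite wave this comes from the continuity of the
    flux at the free boundary, for a positive one from the boundedness of u^m. *)

(** * The potential of the source term *)

Lemma cvg_within_dnbhs (T : topologicalType) (U : topologicalType)
    (A : set T) (f : T -> U) (x : T) :
  f @ within A x^' --> f x -> f @ within A (nbhs x) --> f x.
Proof.
move=> fx B Bfx.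
have H : nbhs x [set y | y != x -> A y -> B (f y)] := fx _ Bfx.
apply: filterS H => y H yA.
have [->|yx] := eqVneq y x; first exact: (nbhs_singleton Bfx).
exact: H.
Qed.

Lemma C1_on_unit_continuous (R : realType) (f : R -> R) :
  C1_on_unit f -> {within `[0, 1], continuous f}.
Proof.
move=> [f' _ df].
suff H (x : R) : `[0, 1]%classic x -> f y @[y --> within `[0, 1] x^'] --> f x.
  by apply/subspace_continuousP => x x01; apply/cvg_within_dnbhs/H.
move=> x01.
have xx : (y - x) @[y --> within `[0, 1] x^'] --> (0 : R).
  rewrite -(subrr x); apply: cvgB; last exact: cvg_cst.
  by apply: cvg_within_filter; apply: cvg_within.
have E : \forall y \near within `[0, 1] x^',
    (y - x) * ((y - x)^-1 * (f y - f x)) + f x = f y.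
  apply: filterS (filterT : nbhs x setT) => y _ yx _ /=.
  by rewrite mulrA divff ?subr_eq0// mul1r subrK.
have := cvgD (cvgM xx (df _ (mem_set x01))) (cvg_cst (f x)).
by rewrite mul0r add0r => L; apply: (cvg_trans (near_eq_cvg E)); exact: L.
Qed.

(** For m < 1 the factor u^(m-1) is singular at 0; there the product is
    u^m times the difference quotient of f, which tends to 0 * f'(0). *)
Lemma continuous_powR_mul_C1 (R : realType) (m : R) (f : R -> R) :
  0 < m -> C1_on_unit f -> f 0 = 0 ->
  {within `[0, 1], continuous (fun u => u `^ (m - 1) * f u)}.
Proof.
move=> m0 fC1 f0; have fc := C1_on_unit_continuous fC1.
suff H (x : R) : `[0, 1]%classic x ->
    y `^ (m - 1) * f y @[y --> within `[0, 1] (nbhs x)] --> x `^ (m - 1) * f x.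
  by apply/subspace_continuousP => x x01; exact: H.
move=> x01.
have [x0|x0] := eqVneq x 0.
  rewrite x0 in x01 *.
  apply: (@cvg_within_dnbhs _ _ _ (fun u => u `^ (m - 1) * f u)).
  rewrite f0 mulr0.
  have [f' _ /(_ _ (mem_set x01)) df] := fC1.
  have um : (u `^ m) @[u --> within `[0, 1] (0:R)^'] --> (0 : R).
    move=> B /(powR_cvg0 m0) H.
    have {}H : nbhs (0 : R) [set y | 0 < y -> B (y `^ m)] := H.
    apply: filterS H => y H y0; rewrite /= in_itv /= => /andP[y1 _].
    by apply: H; rewrite lt_neqAle eq_sym y0.
  have E : \forall y \near within `[0, 1] (0 : R)^',
      y `^ m * ((y - 0)^-1 * (f y - f 0)) = y `^ (m - 1) * f y.
    apply: filterS (filterT : nbhs (0 : R) setT) => y _ y0 /=.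
    rewrite in_itv /= f0 !subr0 => /andP[y1 _].
    by rewrite mulrA -powR_inv1// -powRD//; apply/implyP.
  have := cvgM um df; rewrite mul0r => L.
  by apply: (cvg_trans (near_eq_cvg E)); exact: L.
apply: cvgM; last by move/subspace_continuousP : fc; exact.
apply: cvg_within_filter.
suff : {for x, continuous (fun u : R => u `^ (m - 1))} by [].
apply/differentiable_continuous/derivable1_diffP/derivable_powR.
by move: x01; rewrite !in_itv /= andbT lt_neqAle eq_sym x0 => /andP[].
Qed.

Lemma unit_antiderivative (R : realType) (h : R -> R) :
  {within `[0, 1], continuous h} ->
  exists G : R -> R, [/\ G 0 = 0,
    G 1 = \int[lebesgue_measure]_(u in `[0, 1]) h u,
    {within `[0, 1], continuous G} &
    forall x : R, 0 < x < 1 -> is_derive x 1 G (h x)].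
Proof.
move=> hc.
have hi : (@lebesgue_measure R).-integrable `[0, 1] (EFin \o h).
  exact/continuous_compact_integrable/hc/segment_compact.
exists (fun x => \int[lebesgue_measure]_(u in `[0, x]) h u); split => //.
- by rewrite set_itv1 Rintegral_set1.
- exact: parameterized_integral_continuous.
- move=> x /andP[x0 x1].
  have hx : {for x, continuous h}.
    by apply: (within_continuous_continuous _ hc) => //; rewrite in_itv /= x0.
  have [] := @continuous_FTC1_closed _ h 0 x 1 x1 hi x0 hx.
  by move=> d e; apply: DeriveDef => //; rewrite -derive1E.
Qed.

Lemma continuous_slice (R : realType) (F : R -> R -> R) (t : R) :
  continuous (fun z : R * R => F z.1 z.2) -> continuous (F ^~ t).
Proof.
move=> Fc x.
apply: (@continuous_comp _ _ _ (pair^~ t) (fun z : R * R => F z.1 z.2)).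
  exact: (cvg_pair cvg_id (cvg_cst _)).
exact: Fc.
Qed.

(** * The flux along a travelling wave *)

Section Wave.
Context (R : realType) (m p : R) (f : R -> R) (c : R) (u : R -> R).
Context (m_gt0 : 0 < m) (p_gt1 : 1 < p) (c_gt0 : 0 < c).
Context (f_gt0 : forall z : R, 0 < z < 1 -> 0 < f z).
Context (tw : travelling_wave m p f c u).

Let v := fun x t : R => u (x + c * t).
(* Freezing t = 0 loses nothing: the solution depends on x + c t only. *)
Let W (x : R) := flux m p v x 0.
Let w (x : R) : R := derive1 (fun y => u y `^ m) x.

Lemma wave_fluxE x : W x = `|w x| `^ (p - 2) * w x.
Proof.
rewrite /W /flux /= /partial_x /v /w.
by under eq_fun do rewrite mulr0 addr0.
Qed.

Lemma wave_pow_derivable (x : R) : derivable (fun y => u y `^ m) x 1.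
Proof.
have : derivable (fun y => u (y + c * 0) `^ m) x 1.
  by have [_ _ + _ _] := tw_weak_solution tw; exact.
by under eq_fun do rewrite mulr0 addr0.
Qed.

Lemma wave_continuous : continuous u.
Proof.
have -> : u = fun y => v y 0 by apply/funext => y; rewrite /v mulr0 addr0.
by apply: continuous_slice; have [] := tw_weak_solution tw.
Qed.

Lemma wave_flux_continuous : continuous W.
Proof.
by apply: continuous_slice; have [] := tw_weak_solution tw.
Qed.

Lemma wave_flux_pow x : 0 <= w x -> W x = w x `^ (p - 1).
Proof.
move=> w0; rewrite wave_fluxE ger0_norm// mulrC.
have -> : p - 2 = (p - 1) - 1 by ring.
by rewrite mulr_powRB1// subr_gt0.
Qed.

(** The nonnegative function u^m has a minimum where u vanishes, so its slope is
    zero there. *)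
Lemma wave_flux_zero x : u x = 0 -> W x = 0.
Proof.
move=> ux0; rewrite wave_fluxE.
suff -> : w x = 0 by rewrite mulr0.
have xx : x \in `](x - 1), (x + 1)[%R
  by rewrite in_itv /= ltrBlDr !ltrDl ltr01.
have [] := @derive1_at_min R (fun y => u y `^ m) (x - 1) (x + 1) x _ _ xx _.
- by rewrite lerBlDr -addrA lerDl addr_ge0.
- by move=> t _; exact: wave_pow_derivable.
- by move=> t _; rewrite ux0 powR0 ?gt_eqF// powR_ge0.
by rewrite /w derive1E.
Qed.

Lemma wave_is_derive x : 0 < u x < 1 -> is_derive x 1 u (derive1 u x).
Proof.
by move=> ux; rewrite derive1E; apply: derivableP; exact: (tw_derivable tw).
Qed.

Lemma wave_pow_derive x : 0 < u x < 1 ->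
  w x = m * u x `^ (m - 1) * derive1 u x.
Proof.
move=> ux; have /andP[u0 _] := ux.
have := @is_derive1_comp R (fun y => y `^ m) u x _ _
  (is_derive1_powR m u0) (wave_is_derive ux).
by move=> [_ <-]; rewrite /w derive1E.
Qed.

Lemma wave_pow_derive_gt0 x : 0 < u x < 1 -> 0 < w x.
Proof.
move=> ux; rewrite wave_pow_derive//; have /andP[u0 _] := ux.
by rewrite !mulr_gt0// ?powR_gt0// (tw_derive_gt0 tw).
Qed.

Lemma wave_flux_gt0 x : 0 < u x < 1 -> 0 < W x.
Proof.
move=> ux; have w0 := wave_pow_derive_gt0 ux.
by rewrite wave_flux_pow ?powR_gt0// ltW.
Qed.

Lemma wave_near x : 0 < u x < 1 -> \forall y \near x, 0 < u y < 1.
Proof.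
move=> /andP[u0 u1]; have uc : u y @[y --> x] --> u x by exact: wave_continuous.
near=> y; apply/andP; split; near: y; first exact: (cvgr_gt _ uc).
exact: (cvgr_lt _ uc).
Unshelve. all: by end_near. Qed.

(** The profile equation, read as an equation for the flux: where 0 < u < 1,
    W is m^(p-1) times the quantity differentiated in that equation. *)
Lemma wave_flux_is_derive x : 0 < u x < 1 ->
  is_derive x 1 W (c * derive1 u x - f (u x)).
Proof.
move=> ux; have /andP[u0 u1] := ux.
have [/= dF e] := tw_equation tw ux.
set F := (fun z => _) in dF e.
have WF : \near x, m `^ (p - 1) * F x = W x.
  near=> y.
  have uy : 0 < u y < 1 by near: y; exact: wave_near.
  have u'0 := tw_derive_gt0 tw uy; have /andP[uy0 _] := uy.
  rewrite wave_flux_pow ?ltW ?wave_pow_derive_gt0// wave_pow_derive//.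
  rewrite !powRM ?mulr_ge0 ?powR_ge0 ?ltW//.
  by rewrite /F -powRrM mulrA.
apply: near_eq_is_derive WF _.
have -> : c * derive1 u x - f (u x) = m `^ (p - 1) * derive1 F x.
  by rewrite e addrK.
rewrite derive1E; have dF' := derivableP dF.
exact: (@is_deriveZ _ _ _ F (m `^ (p - 1))).
Unshelve. all: by end_near. Qed.

Lemma wave_between a b x : 0 < u a -> u b < 1 -> a <= x <= b -> 0 < u x < 1.
Proof.
move=> ua ub /andP[ax xb].
rewrite (lt_le_trans ua) ?(tw_nondecreasing tw)//=.
by rewrite (le_lt_trans _ ub)// (tw_nondecreasing tw).
Qed.

(** By monotonicity of u the points where 0 < u < 1 form an interval, so the
    sign of a derivative there decides monotonicity. *)
Lemma wave_nincr (H dH : R -> R) :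
  (forall x, 0 < u x < 1 -> is_derive x 1 H (dH x)) ->
  (forall x, 0 < u x < 1 -> dH x <= 0) ->
  forall a b, a <= b -> 0 < u a -> u b < 1 -> H b <= H a.
Proof.
move=> HdH dH0 a b ab ua ub.
have reg x : a <= x <= b -> 0 < u x < 1 by exact: wave_between.
apply: (@ler0_derive1_nincr _ H a b) => //.
- move=> x /[!in_itv]/= /andP[/ltW ax /ltW xb].
  by have [] := HdH x (reg x _); rewrite ?ax.
- move=> x /[!in_itv]/= /andP[/ltW ax /ltW xb].
  have ux : 0 < u x < 1 by apply: reg; rewrite ax.
  by have [_] := HdH x ux; rewrite derive1E => ->; exact: dH0.
- apply: derivable_within_continuous => x /[!in_itv]/= xab.
  by have [] := HdH x (reg x xab).
Qed.

(** * The left end of the wave *)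

(** Finite wave: at the last zero of u both u and W vanish, and both are
    continuous, so points just to the right of it are suitable. *)
Lemma wave_left_vanishing e x : 0 < e -> 0 < u x < 1 -> (exists z, u z = 0) ->
  exists a, [/\ a <= x, 0 < u a, u a <= e & W a <= e].
Proof.
move=> e0 /andP[ux0 ux1] [z uz].
pose A := [set y | u y = 0].
have A0 : A !=set0 by exists z.
have xA : ubound A x.
  move=> y; rewrite /A /= => uy; rewrite leNgt; apply/negP => /ltW xy.
  by have := tw_nondecreasing tw xy; rewrite uy leNgt ux0.
have cA : closed A.
  apply: (@preimage_closed _ _ u [set 0]); last exact: closed_eq.
  by move=> y _; exact: wave_continuous.
have us : u (sup A) = 0.
  by have := closure_sup A0 (ex_intro _ x xA); rewrite -(closure_id A).1.
have sx : sup A < x.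
  rewrite lt_neqAle ge_sup// andbT; apply: contraTneq ux0 => <-.
  by rewrite us ltxx.
near (sup A)^'+ => a; exists a; split.
- by near: a; exact: nbhs_right_le.
- have sa : sup A < a by near: a; exact: nbhs_right_gt.
  have /andP[+ _] := tw_range tw a; rewrite le_eqVlt => /predU1P[ua|//].
  have : a <= sup A by apply: sup_ubound => //; exists x.
  by rewrite leNgt sa.
- near: a; apply: cvgr_le; last by rewrite -us in e0; exact: e0.
  by apply: cvg_at_right_filter; exact: wave_continuous.
- near: a; apply: cvgr_le.
  2: by rewrite -(wave_flux_zero us) in e0; exact: e0.
  by apply: cvg_at_right_filter; exact: wave_flux_continuous.
Unshelve. all: by end_near. Qed.

(** Positive wave: u^m stays below 1, so over an interval of length L it has
    slope at most 1/L somewhere, and the flux is the (p-1)-th power of the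
    slope. *)
Lemma wave_left_positive e x : 0 < e -> 0 < u x < 1 -> (forall z, 0 < u z) ->
  exists a, [/\ a <= x, 0 < u a, u a <= e & W a <= e].
Proof.
move=> e0 /andP[ux0 ux1] upos.
near (-oo : set_system R) => b.
have bx : b <= x by near: b; apply: nbhs_ninfty_le; exact: num_real.
have ube : u b <= e.
  by near: b; apply: cvgr_le; [exact: tw_cvg_ninfty tw|exact: e0].
(* A slope of at most k means a flux of at most k^(p-1) = e. *)
pose k := e `^ ((p - 1)^-1).
have k0 : 0 < k by rewrite powR_gt0.
have bk : b - k^-1 < b by rewrite ltrBlDr ltrDl invr_gt0.
have dw y : y \in `](b - k^-1), b[%R -> is_derive y 1 (fun y => u y `^ m) (w y).
  move=> _; rewrite /w derive1E; apply: derivableP.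
  exact: wave_pow_derivable.
have [|a] := MVT bk dw.
  by apply: derivable_within_continuous => y _; exact: wave_pow_derivable.
rewrite in_itv/= => /andP[_ /ltW ab].
have -> : b - (b - k^-1) = k^-1 by ring.
move=> E.
have uae : u a <= e by rewrite (le_trans _ ube)// (tw_nondecreasing tw).
have ua : 0 < u a < 1.
  rewrite upos (le_lt_trans _ ux1)// (tw_nondecreasing tw)//.
  exact: le_trans ab bx.
have w0 := wave_pow_derive_gt0 ua.
exists a; split => //; first exact: le_trans ab bx.
rewrite (wave_flux_pow (ltW w0)).
have -> : e = k `^ (p - 1).
  by rewrite /k -powRrM mulVf ?powRr1// ?ltW// subr_eq0 gt_eqF.
apply: ge0_ler_powR; rewrite ?nnegrE ?subr_ge0; [exact: ltW..|].
rewrite -[leRHS]mul1r -ler_pdivrMr// -E.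
have ub1 : u b `^ m <= 1.
  suff : u b `^ m <= 1 `^ m by rewrite powR1.
  apply: ge0_ler_powR; rewrite ?nnegrE ?ler01//; [exact: ltW..|].
  by rewrite (le_trans _ (ltW ux1))// (tw_nondecreasing tw).
by rewrite (le_trans _ ub1)// lerBlDr lerDl powR_ge0.
Unshelve. all: by end_near. Qed.

Lemma wave_left_end e x : 0 < e -> 0 < u x < 1 ->
  exists a, [/\ a <= x, 0 < u a, u a <= e & W a <= e].
Proof.
move=> e0 ux.
have [uz|nuz] := pselect (exists z, u z = 0); first exact: wave_left_vanishing.
apply: wave_left_positive => // z; have /andP[+ _] := tw_range tw z.
by rewrite le_eqVlt => /predU1P[uz|//]; exfalso; apply: nuz; exists z.
Qed.

(** W - c u has derivative - f(u) <= 0 and is arbitrarily small at suitable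
    points to the left. *)
Lemma wave_flux_le x : 0 < u x < 1 -> W x <= c * u x.
Proof.
move=> ux; apply/ler_addgt0Pr => e e0.
have [a [ax ua uae Wae]] := wave_left_end e0 ux.
have /andP[_ ux1] := ux.
have := @wave_nincr (fun y => W y - c * u y)
  (fun y => (c * derive1 u y - f (u y)) - c * derive1 u y) _ _ a x ax ua ux1.
have -> : (W x - c * u x <= W a - c * u a) = (W x <= W a - c * u a + c * u x).
  by rewrite lerBlDr.
move=> /(_ _ _)/le_trans; apply.
- move=> y uy; have dW := wave_flux_is_derive uy; have du := wave_is_derive uy.
  by apply: is_deriveB; exact: is_deriveZ.
- by move=> y uy; rewrite addrAC subrr sub0r oppr_le0 ltW// f_gt0.
- rewrite addrC lerD2l (le_trans _ Wae)// gerBl mulr_ge0// ltW//.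
Qed.

(** * The energy of a travelling wave *)

Context (G : R -> R).
Context (G0 : G 0 = 0) (G_continuous : {within `[0, 1], continuous G}).
Context (dG : forall z : R, 0 < z < 1 ->
  is_derive z 1 G (z `^ (m - 1) * f z)).

(* Conjugate exponent of p. *)
Let k := p / (p - 1).
Let K := (p - 1) / (m * p).
Let H x := G (u x) + K * (W x `^ k - (c * u x) `^ k).

(** The factor K makes K k = 1/m, so that, as W^(k-1) = m u^(m-1) u', the
    term - K k W^(k-1) f(u) coming from W' cancels the derivative of G(u). *)
Lemma wave_energy_is_derive x : 0 < u x < 1 ->
  is_derive x 1 H
    (c * derive1 u x / m * (W x `^ (k - 1) - (c * u x) `^ (k - 1))).
Proof.
move=> ux; have /andP[ux0 _] := ux.
have p0 : p != 0 by rewrite gt_eqF// (lt_trans ltr01).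
have p10 : p - 1 != 0 by rewrite subr_eq0 gt_eqF.
have m0 : m != 0 by rewrite gt_eqF.
have dW := wave_flux_is_derive ux; have du := wave_is_derive ux.
have W0 := wave_flux_gt0 ux.
have cu0 : 0 < c * u x by rewrite mulr_gt0.
have dGu := @is_derive1_comp R G u x _ _ (dG ux) du.
have dWk := @is_derive1_comp R (fun z => z `^ k) W x _ _
  (is_derive1_powR k W0) dW.
have dcu := is_deriveZ c du.
have dcuk := @is_derive1_comp R (fun z => z `^ k) (c \*: u) x _ _
  (is_derive1_powR k cu0) dcu.
apply: (is_derive_eq (is_deriveD dGu (is_deriveZ K (is_deriveB dWk dcuk)))).
have Wk : W x `^ (k - 1) = m * u x `^ (m - 1) * derive1 u x.
  have w0 := wave_pow_derive_gt0 ux.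
  rewrite (wave_flux_pow (ltW w0)) -powRrM.
  have -> : (p - 1) * (k - 1) = 1 by rewrite /k; field.
  by rewrite powRr1 ?ltW// wave_pow_derive.
rewrite Wk /K /k /GRing.scale /=; field.
by rewrite m0 p0 p10.
Qed.

Lemma wave_energy_nincr a b : a <= b -> 0 < u a -> u b < 1 -> H b <= H a.
Proof.
apply: (@wave_nincr H (fun x =>
  c * derive1 u x / m * (W x `^ (k - 1) - (c * u x) `^ (k - 1)))).
  exact: wave_energy_is_derive.
move=> x ux; have /andP[ux0 _] := ux.
have u'0 := tw_derive_gt0 tw ux.
apply: mulr_ge0_le0; first by rewrite ltW// divr_gt0// mulr_gt0.
rewrite subr_le0; apply: ge0_ler_powR; rewrite ?nnegrE.
- by rewrite subr_ge0 /k ler_pdivlMr ?subr_gt0// mul1r gerBl.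
- exact/ltW/wave_flux_gt0.
- by rewrite ltW// mulr_gt0.
- exact: wave_flux_le.
Qed.

(** The energy is nonincreasing and, at the left end, G(u) and W^k are both as
    small as desired; hence H <= 0, and W^k >= 0 can be dropped. *)
Lemma wave_potential_le x : 0 < u x < 1 -> G (u x) <= K * (c * u x) `^ k.
Proof.
move=> ux; have /andP[_ ux1] := ux.
have p0 : 0 < p by rewrite (lt_trans ltr01).
have p10 : 0 < p - 1 by rewrite subr_gt0.
have k0 : 0 < k by rewrite divr_gt0.
have K0 : 0 <= K by rewrite divr_ge0 ?mulr_ge0// ltW.
suff Hx : H x <= 0.
  rewrite -subr_le0 (le_trans _ Hx)// /H lerD2l mulrBr -[leLHS]add0r lerD2r.
  by rewrite mulr_ge0// powR_ge0.
apply/ler_addgt0Pr => e e0; rewrite add0r [e]splitr.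
have e20 : 0 < e / 2 by rewrite divr_gt0.
have [_ G0r _] := (continuous_within_itvP _ ltr01).1 G_continuous.
have [d /= d0 Gd] : \forall y \near 0^'+, G y <= e / 2.
  by apply: (cvgr_le (G 0)); [exact: G0r|rewrite G0].
have Kk : K * s `^ k @[s --> (0:R)^'+] --> (0 : R).
  by have L := cvgM (cvg_cst K) (powR_cvg0 k0); rewrite mulr0 in L; exact: L.
near (0 : R)^'+ => s.
have s0 : 0 < s by near: s; exact: nbhs_right_gt.
have sd : s < d by near: s; exact: nbhs_right_lt.
have Ks : K * s `^ k <= e / 2.
  by near: s; apply: (cvgr_le 0); [exact: Kk|].
have [a [ax ua uas Was]] := wave_left_end s0 ux.
apply: le_trans (wave_energy_nincr ax ua ux1) _; apply: lerD.
  apply: Gd => //=; rewrite sub0r normrN gtr0_norm//.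
  exact: le_lt_trans uas sd.
apply: le_trans Ks; rewrite ler_wpM2l// (@le_trans _ _ (W a `^ k))//.
  by rewrite gerBl powR_ge0.
have Wa : 0 < W a.
  apply: wave_flux_gt0; apply: (wave_between ua ux1).
  by rewrite lexx.
apply: ge0_ler_powR; rewrite ?nnegrE ?(ltW k0) ?(ltW Wa) ?(ltW s0)//.
Unshelve. all: by end_near. Qed.

(** Makes the bound on G(u) a bound on G(y) for every y in ]0, 1[; the profile
    may reach 1, or only tend to it. *)
Lemma wave_onto y : 0 < y < 1 -> exists x, u x = y.
Proof.
move=> /andP[y0 y1].
near (-oo : set_system R) => a; near (+oo : set_system R) => b.
have ua : u a < y by near: a; apply: cvgr_lt; [exact: tw_cvg_ninfty tw|].
have ub : y < u b by near: b; apply: cvgr_gt; [exact: tw_cvg_pinfty tw|].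
have ab : a <= b.
  rewrite leNgt; apply/negP => /ltW /(tw_nondecreasing tw).
  by rewrite leNgt (lt_trans ua).
have [||x _ ux] := @IVT R u a b y ab.
- by apply: continuous_subspaceT; exact: wave_continuous.
- by rewrite ge_min le_max (ltW ua) (ltW ub) orbT.
by exists x.
Unshelve. all: by end_near. Qed.

Lemma wave_total_potential_le : G 1 <= K * c `^ k.
Proof.
have [_ _ G1] := (continuous_within_itvP _ ltr01).1 G_continuous.
apply: (cvgr_to_le G1); near=> y.
have y0 : 0 < y by near: y; apply: nbhs_left_gt.
have y1 : y < 1 by near: y; apply: nbhs_left_lt.
have [x ux] : exists x, u x = y by apply: wave_onto; rewrite y0.
have := @wave_potential_le x; rewrite ux y0 y1 => /(_ isT) /le_trans; apply.
have p0 : 0 < p by rewrite (lt_trans ltr01).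
have p10 : 0 < p - 1 by rewrite subr_gt0.
rewrite ler_wpM2l ?divr_ge0 ?mulr_ge0 ?(ltW p0) ?(ltW p10) ?(ltW m_gt0)//.
apply: ge0_ler_powR; rewrite ?nnegrE.
- by rewrite divr_ge0// ltW.
- by rewrite mulr_ge0// ltW.
- exact: ltW.
- by rewrite ger_pMr// ltW.
Unshelve. all: by end_near. Qed.

End Wave.

(** * The lower bound on the minimal speed *)

Theorem lemma1 (R : realType) (m p : R) (f : R -> R) (cstar : R)
    (hm : 0 < m) (hp : 1 < p) (hgamma : 0 <= m * (p - 1) - 1)
    (hfC1 : C1_on_unit f) (hf0 : f 0 = 0) (hf1 : f 1 = 0)
    (hfpos : forall u, 0 < u < 1 -> 0 < f u)
    (hfconc : concave_on_unit f)
    (hcstar : minimal_speed m p f cstar) :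
  (m * p / (p - 1)) `^ ((p - 1) / p) *
  (\int[lebesgue_measure]_(u in `[0, 1]) (u `^ (m - 1) * f u))
    `^ ((p - 1) / p)
  <= cstar.
Proof.
have [c0 /(_ cstar (lexx _)) [u tw] _] := hcstar.
have [G [G0 G1 Gc dG]] :=
  unit_antiderivative (continuous_powR_mul_C1 hm hfC1 hf0).
have := wave_total_potential_le hm hp c0 hfpos tw G0 Gc dG.
rewrite G1; set I := Rintegral _ _ _ => I_le.
have p0 : 0 < p by rewrite (lt_trans ltr01).
have p10 : 0 < p - 1 by rewrite subr_gt0.
have A0 : 0 < m * p / (p - 1) by rewrite divr_gt0 ?mulr_gt0.
have I0 : 0 <= I.
  apply: Rintegral_ge0 => x /=; rewrite in_itv/= => /andP[x0 x1].
  rewrite mulr_ge0 ?powR_ge0//.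
  move: x0; rewrite le_eqVlt => /predU1P[<-|x0]; first by rewrite hf0.
  move: x1; rewrite le_eqVlt => /predU1P[->|x1]; first by rewrite hf1.
  by rewrite ltW// hfpos// x0.
rewrite -powRM ?(ltW A0)//.
have -> : cstar = (cstar `^ (p / (p - 1))) `^ ((p - 1) / p).
  rewrite -powRrM mulrA divfK ?gt_eqF// divff ?gt_eqF// powRr1//.
  exact: ltW.
apply: ge0_ler_powR; rewrite ?nnegrE ?powR_ge0//.
- by rewrite divr_ge0// ltW.
- by rewrite mulr_ge0// ltW.
- by rewrite -ler_pdivlMl// invf_div.
Qed.
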